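(* Let $X,Y$ be independent random variables with distributions $F,G$ respectively, and let $F*G$ denote the distribution of $X+Y$. 1. Assume that $F$ and $G$ have support the whole real axis $\mathbb{R}$. (a) If $F\in\mathcal{P_D}$, $\overline G(x)=o[\overline F(x)]$ as $x\to\infty$, and $G\in\mathcal{OL}$, then $F*G\in\mathcal{P_D}$. (b) If $F\in\mathcal{OT}$, $\overline G(x)=o[\overline F(x)]$ as $x\to\infty$, and $G\in\mathcal{OL}$, then $F*G\in\mathcal{OT}$. 2. Assume that $F$ and $G$ have support $\mathbb{R}_+=[0,\infty)$ and have densities $f$ and $g$ respectively, with $f$ of bounded increase, that $0<\beta_F<\beta_G$, and that $\liminf_{x\to\infty}x^q\,\overline F(x)>0$ for some $q\in[\beta_F,\beta_G)$. (a) If $F,G\in\mathcal{OA}$, then $F*G\in\mathcal{OA}$. (b) If $F,G\in\mathcal{OT}$, then $F*G\in\mathcal{OT}$. 3. Let $X_1,\ldots,X_n$, with $n\ge 2$, be independent random variables with distributions $F_1,\ldots,F_n$ respectively, with support $\mathbb{R}_+$. Assume that $F_1\in\mathcal{OA}$ and $$0<\liminf_{x\to\infty}\inf_{1\le l\le n}\frac{\overline F_l(x)}{\overline F_1(x)}\le\limsup_{x\to\infty}\sup_{1\le l\le n}\frac{\overline F_l(x)}{\overline F_1(x)}<\infty .$$ Then the distribution $F_{S_n}$ of the sum $S_n:=\sum_{i=1}^nX_i$ satisfies $F_{S_n}\in\mathcal{OA}$. 4. If $F,G$ have support $\mathbb{R}_+$ and either $F\in\mathcal{L}\cap\mathcal{OA}$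 and $G\in\mathcal{OA}$, or alternatively $G\in\mathcal{L}\cap\mathcal{OA}$ and $F\in\mathcal{OA}$, then $F*G\in\mathcal{OA}$. 5. If $F,G$ have support $\mathbb{R}_+$ and $F,G\in\mathcal{L}\cap\mathcal{OA}$, then $F*G\in\mathcal{L}\cap\mathcal{OA}$.
   Context: For a distribution $F$, $\overline F(x)=1-F(x)$ denotes its tail; all distributions satisfy $\overline F(x)>0$ for every $x\ge0$. $F^{*2}$ is the convolution of $F$ with itself. Classes of distributions: - $F\in\mathcal{P_D}$ (positively decreasing) if $\limsup_{x\to\infty}\overline F(vx)/\overline F(x)<1$ for some $v>1$. - $F\in\mathcal{L}$ (long-tailed) if $\lim_{x\to\infty}\overline F(x-y)/\overline F(x)=1$ for every $y\ne 0$. - $F\in\mathcal{OL}$ (generalized long-tailed) if $\limsup_{x\to\infty}\overline F(x-t)/\overline F(x)<\infty$ for every $t\neq 0$. - $F\in\mathcal{OS}$ (generalized subexponential) if $\limsup_{x\to\infty}\overline{F^{*2}}(x)/\overline F(x)<\infty$. - $\mathcal{OT}:=\mathcal{OL}\cap\mathcal{P_D}$ and $\mathcal{OA}:=\mathcal{OS}\cap\mathcal{P_D}$. Lower Matuszewska index: with $\overline F^*(v):=\limsup_{x\to\infty}\overline F(vx)/\overline F(x)$, $$\beta_F:=\sup\Big\{-\frac{\ln\overline F^*(v)}{\ln v}: v>1\Big\}\in[0,\infty].$$ A positive function $f$ is of bounded increase (in the sense of Bingham, Goldie and Teugels) if its upper Matuszewska index is finite, that is, there exist $\alpha\in\mathbb{R}$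 and $C>0$ such that for every $\Lambda>1$, as $x\to\infty$, $f(\lambda x)/f(x)\le C(1+o(1))\lambda^{\alpha}$ uniformly in $\lambda\in[1,\Lambda]$. *)

(* Defs.v *)
From HB Require Import structures.
From mathcomp Require Import all_boot all_order all_algebra.
From mathcomp Require Import all_classical all_reals all_analysis.
From mathcomp Require Import measurable_realfun.

Set Implicit Arguments.
Unset Strict Implicit.
Unset Printing Implicit Defensive.

Import Order.TTheory GRing.Theory Num.Theory.
Import numFieldNormedType.Exports.

Local Open Scope classical_set_scope.
Local Open Scope ring_scope.

Section Distributions.
Context {R : realType}.
Implicit Types F G : set R -> \bar R.

(* Distributions are identified with their laws, i.e. set functions on R; for
   a probability law F, the value F `]-oo, x] is the distribution function. *)
Definition tail F (x : R) : R := 1 - fine (F `]-oo, x]%classic).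

Definition tail_pos F : Prop := forall x : R, 0 <= x -> 0 < tail F x.

(* "F has support S" in the usual sense of heavy-tail theory: no mass outside
   S (so a law on `[1, +oo[ also has support R_+, and S = R is no restriction).
   This is weaker than requiring the topological support to be equal to S. *)
Definition has_support F (S : set R) : Prop := F (~` S) = 0%E.

Definition has_density F (f : R -> R) : Prop :=
  [/\ measurable_fun [set: R] f,
      (forall x, 0 <= f x) &
      forall A : set R, measurable A ->
        F A = (\int[lebesgue_measure]_(x in A) (f x)%:E)%E].

Definition convolution (F G : {measure set R -> \bar R}) : set R -> \bar R :=
  pushforward (F \x G)%E (fun z : R * R => z.1 + z.2).

Definition limsup_pinfty (h : R -> \bar R) : \bar R := limf_esup h +oo%R.
Definition liminf_pinfty (h : R -> \bar R) : \bar R := limf_einf h +oo%R.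

Definition tail_star F (v : R) : \bar R :=
  limsup_pinfty (fun x => (tail F (v * x) / tail F x)%:E).

Definition class_PD F : Prop := exists2 v : R, 1 < v & (tail_star F v < 1)%E.

Definition class_L F : Prop :=
  forall y : R, y != 0 -> tail F (x - y) / tail F x @[x --> +oo] --> (1 : R).

Definition class_OL F : Prop :=
  forall t : R, t != 0 ->
    (limsup_pinfty (fun x => (tail F (x - t) / tail F x)%:E) < +oo)%E.

Definition class_OS (F : {measure set R -> \bar R}) : Prop :=
  (limsup_pinfty (fun x => (tail (convolution F F) x / tail F x)%:E) < +oo)%E.

Definition class_OT F : Prop := class_OL F /\ class_PD F.

Definition class_OA (F : {measure set R -> \bar R}) : Prop :=
  class_OS F /\ class_PD F.

(* [lne 0 = -oo], so that beta is +oo as soon as some [tail_star F v] is 0. *)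
Definition lower_Matuszewska F : \bar R :=
  ereal_sup [set (- lne (tail_star F v) * ((ln v)^-1)%:E)%E
            | v in [set v : R | 1 < v]].

(* Only the values of f near +oo matter, hence positivity is required there;
   it must be explicit because division by 0 is total. *)
Definition bounded_increase (f : R -> R) : Prop :=
  (\forall x \near +oo, 0 < f x) /\
  exists alpha C : R, 0 < C /\
    forall Lambda : R, 1 < Lambda ->
    forall eps : R, 0 < eps ->
    \forall x \near +oo, forall lambda : R, 1 <= lambda <= Lambda ->
      f (lambda * x) / f x <= C * (1 + eps) * lambda `^ alpha.

End Distributions.

Section Independence.
Context {d : measure_display} {T : measurableType d} {R : realType}.
Variable P : probability T R.

Definition independent (X Y : {RV P >-> R}) : Prop :=
  forall A B : set R, measurable A -> measurable B ->
    P (X @^-1` A `&` Y @^-1` B) = (P (X @^-1` A) * P (Y @^-1` B))%E.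

Definition mutually_independent (I : finType) (X : I -> {RV P >-> R}) : Prop :=
  forall (J : {set I}) (A : I -> set R), (forall i, measurable (A i)) ->
    P (\bigcap_(i in [set` J]) (X i @^-1` A i)) =
    (\prod_(i in J) P (X i @^-1` A i))%E.

End Independence.

(* Main.v *)
Require Import Defs.
From HB Require Import structures.
From mathcomp Require Import all_boot all_order all_algebra.
From mathcomp Require Import all_classical all_reals all_analysis.
From mathcomp Require Import measurable_realfun.
From mathcomp Require Import ring lra.

Set Implicit Arguments.
Unset Strict Implicit.
Unset Printing Implicit Defensive.

Import Order.TTheory GRing.Theory Num.Theory.
Import numFieldNormedType.Exports.

Local Open Scope classical_set_scope.
Local Open Scope ring_scope.

(* For independent X, Y with laws F, G and any x, y, the tail H of X + Y satisfies
     F(x) G(0) <= H(x)   and   H(x + y) <= F(x) + G(y),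
   and the class PD means that F(vx) <= e F(x) eventually, for every e > 0 and a
   suitable v; the factor 2 lost in bounding H(2x) by F(x) + G(x) is therefore
   harmless.  OL and OS pass to sums by integrating pointwise bounds such as
   F(x - t) <= C F(x), which hold for all x once they hold near infinity because
   tails are positive and bounded; for OS one iterates H * G <= C H, where
   H * G = F * (G * G).  In parts 2 and 3 the other tails are O(F), and {A : A = O(F)}
   is stable under convolution when F is in OS.  Part 5 is the Embrechts-Goldie
   decomposition of the event {X + Y > x}. *)

(** * Product measures through sections, and the half-plane above a level of the sum *)

Section ProductMeasures.
Context {R : realType}.
Implicit Types A B : probability R R.
Local Open Scope ereal_scope.

(** [\x] integrates x-sections and [\x^] integrates y-sections; both agree on rectangles, so
    uniqueness identifies them. *)
Lemma product_measure_ysection A B (S : set (R * R)) : measurable S ->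
  (A \x B) S = \int[B]_y A (ysection S y).
Proof.
move=> mS; apply: (@product_measure_unique _ _ _ _ _ A B (A \x^ B)) => // U V mU mV.
exact: product_measure2E.
Qed.

Lemma le_product_measure_ysection A A' B (S S' : set (R * R)) (C : R) :
  (0 <= C)%R -> measurable S -> measurable S' ->
  (forall y, A (ysection S y) <= C%:E * A' (ysection S' y)) ->
  (A \x B) S <= C%:E * (A' \x B) S'.
Proof.
move=> C0 mS mS' h; rewrite !product_measure_ysection//.
rewrite -ge0_integralZl//; last by have := @measurable_fun_ysection _ _ _ _ _ A' _ mS'.
apply: ge0_le_integral => //.
- by have := @measurable_fun_ysection _ _ _ _ _ A _ mS.
- apply: emeasurable_funM => //.
  by have := @measurable_fun_ysection _ _ _ _ _ A' _ mS'.
Qed.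

Lemma le_product_measure_xsection A B B' (S S' : set (R * R)) (C : R) :
  (0 <= C)%R -> measurable S -> measurable S' ->
  (forall x, B (xsection S x) <= C%:E * B' (xsection S' x)) ->
  (A \x B) S <= C%:E * (A \x B') S'.
Proof.
move=> C0 mS mS' h; rewrite /product_measure1.
rewrite -ge0_integralZl//; last by have := @measurable_fun_xsection _ _ _ _ _ B' _ mS'.
apply: ge0_le_integral => //.
- by have := @measurable_fun_xsection _ _ _ _ _ B _ mS.
- apply: emeasurable_funM => //.
  by have := @measurable_fun_xsection _ _ _ _ _ B' _ mS'.
- by move=> x _; exact: h.
Qed.

Lemma fin_num_product_measure A B (S : set (R * R)) : measurable S ->
  (A \x B) S \is a fin_num.
Proof. by move=> mS; exact: (fin_num_measure ((A \x B) : probability _ _)). Qed.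

Definition exceed (x : R) : set (R * R) := [set z | (x < z.1 + z.2)%R].

Lemma measurable_exceed x : measurable (exceed x).
Proof.
rewrite (_ : exceed x = (fun z : R * R => (z.1 + z.2)%R) @^-1` `]x, +oo[); last first.
  by apply/seteqP; split=> z /=; rewrite in_itv/= andbT.
rewrite -[X in measurable X]setTI.
by apply: (measurable_funD measurable_fst measurable_snd).
Qed.

Lemma ysection_exceed x y : ysection (exceed x) y = `](x - y)%R, +oo[%classic.
Proof.
apply/seteqP; split=> z; rewrite /ysection/= inE /exceed/= in_itv/= andbT; lra.
Qed.

Lemma xsection_exceed x y : xsection (exceed x) y = `](x - y)%R, +oo[%classic.
Proof.
apply/seteqP; split=> z; rewrite /xsection/= inE /exceed/= in_itv/= andbT; lra.
Qed.

End ProductMeasures.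

Lemma onee_subK {R : realType} (u : \bar R) : u \is a fin_num -> (1 - (1 - u))%E = u.
Proof. by case: u => // u _; rewrite -!EFinB subKr. Qed.

(** * Tails as probabilities of right half-lines *)

Section Tail.
Context {R : realType}.
Implicit Types A B : probability R R.

Lemma EFin_tail A x : (tail A x)%:E = A `]x, +oo[%classic.
Proof.
rewrite /tail EFinB fineK ?fin_num_measure//.
have -> : `]-oo, x]%classic = ~` `]x, +oo[%classic by rewrite setCitvr.
by rewrite probability_setC// onee_subK// fin_num_measure.
Qed.

Lemma tail_ge0 A x : 0 <= tail A x.
Proof. by rewrite -lee_fin EFin_tail. Qed.

Lemma tail_le1 A x : tail A x <= 1.
Proof. by rewrite -lee_fin EFin_tail probability_le1. Qed.

Lemma le_tail A x y : x <= y -> tail A y <= tail A x.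
Proof.
move=> xy; rewrite -lee_fin !EFin_tail le_measure ?inE//.
by apply: subitvPl; rewrite bnd_simp.
Qed.

(** Monotonicity carries positivity over to negative levels, so ratios of tails are meaningful
    everywhere. *)
Lemma tail_gt0 A x : tail_pos A -> 0 < tail A x.
Proof.
move=> A0; apply: (@lt_le_trans _ _ (tail A (Num.max x 0))).
  by apply: A0; rewrite le_max lexx orbT.
by apply: le_tail; rewrite le_max lexx.
Qed.

End Tail.

(** * The tail of an independent sum, computed from the two laws *)

Section TailSum.
Context {R : realType}.
Implicit Types A B D H K : probability R R.

(** The real-valued tail of the convolution. Depending on laws only, it also covers F with itself,
    where no independent copy of the variable is at hand. *)
Definition sum_tail A B (x : R) : R := fine ((A \x B)%E (exceed x)).

Lemma EFin_sum_tail A B x : (sum_tail A B x)%:E = (A \x B)%E (exceed x).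
Proof. by rewrite fineK//; apply: fin_num_product_measure; exact: measurable_exceed. Qed.

Lemma tail_convolution A B x : tail (convolution A B) x = sum_tail A B x.
Proof.
apply: EFin_inj; rewrite EFin_sum_tail /tail /convolution /pushforward EFinB.
have mS := measurable_exceed x.
have -> : (fun z : R * R => z.1 + z.2) @^-1` `]-oo, x] = ~` exceed x.
  by apply/seteqP; split=> z /=; rewrite in_itv/= /exceed/= leNgt => /negP.
rewrite fineK; last by apply: fin_num_product_measure; exact: measurableC.
rewrite [in X in (_ - X)%E](@probability_setC _ _ _ (A \x B)%E)//.
by rewrite onee_subK//; exact: fin_num_product_measure.
Qed.

Lemma sum_tailC A B x : sum_tail A B x = sum_tail B A x.
Proof.
apply: EFin_inj; rewrite !EFin_sum_tail product_measure_ysection; last exact: measurable_exceed.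
by apply: eq_integral => y _ /=; rewrite ysection_exceed xsection_exceed.
Qed.

(** Condition on the second summand and integrate. The two levels may differ, so shifts and changes
    of law are both covered. *)
Lemma le_sum_tail A A' B (C x x' : R) : 0 <= C ->
  (forall y, tail A (x - y) <= C * tail A' (x' - y)) ->
  sum_tail A B x <= C * sum_tail A' B x'.
Proof.
move=> C0 h; rewrite -lee_fin EFinM !EFin_sum_tail.
apply: le_product_measure_ysection => //; try exact: measurable_exceed.
by move=> y; rewrite !ysection_exceed -!EFin_tail -EFinM lee_fin.
Qed.

(** The half-plane contains the quadrant where X > x and Y > 0. *)
Lemma sum_tail_ge A B x : tail A x * tail B 0 <= sum_tail A B x.
Proof.
rewrite -lee_fin EFinM !EFin_tail EFin_sum_tail -product_measure1E//.
apply: le_measure; rewrite ?inE//.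
- exact: measurableX.
- exact: measurable_exceed.
- by move=> [a b]/=; rewrite /exceed/= !in_itv/= !andbT => -[]; lra.
Qed.

(** If X + Y > x + y, then X > x or Y > y. *)
Lemma sum_tail_le A B x y : sum_tail A B (x + y) <= tail A x + tail B y.
Proof.
rewrite -lee_fin EFinD !EFin_tail EFin_sum_tail.
rewrite -[X in (_ <= X + _)%E]mule1 -[X in (_ <= _ + X)%E]mul1e.
rewrite -{1}(probability_setT B) -(probability_setT A) -!product_measure1E//.
apply: le_trans (measureU2 _ _ _); [|exact: measurableX..].
apply: le_measure; rewrite ?inE//.
- exact: measurable_exceed.
- by apply: measurableU; exact: measurableX.
- move=> [a b]/=; rewrite /exceed/= !in_itv/= !andbT => ab.
  by have [xa|xa] := ltP x a; [left|right]; split => //; lra.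
Qed.

Lemma measurable_tail A : measurable_fun [set: R] (tail A).
Proof. by apply: nonincreasing_measurable => // x y; exact: le_tail. Qed.

Lemma EFin_sum_tail_int A B x :
  (sum_tail A B x)%:E = (\int[B]_y (tail A (x - y))%:E)%E.
Proof.
rewrite EFin_sum_tail product_measure_ysection; last exact: measurable_exceed.
by apply: eq_integral => y _; rewrite ysection_exceed EFin_tail.
Qed.

(* Fubini: [H * K = A * (B * K)] for [H = A * B]. *)
Lemma sum_tail_absorb A B D H K (C x : R) : 0 <= C ->
  (forall y, tail H y = sum_tail A B y) ->
  (forall y, sum_tail B K y <= C * tail D y) ->
  sum_tail H K x <= C * sum_tail D A x.
Proof.
move=> C0 hH hB; rewrite -lee_fin EFin_sum_tail_int.
have mT : measurable_fun [set: R * R] (fun z : R * R => (tail B (x - z.1 - z.2))%:E).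
  apply/measurable_EFinP; apply: measurableT_comp; first exact: measurable_tail.
  by apply: measurable_funB => //; apply: measurable_funB.
(* Swapping the summands of H makes A the inner integration variable; after Fubini, B meets K in the
   inner integral. *)
under eq_integral do rewrite hH sum_tailC EFin_sum_tail_int.
have T0 (z : R * R) : (0 <= (tail B (x - z.1 - z.2))%:E)%E by rewrite lee_fin tail_ge0.
have /= E := @fubini_tonelli _ _ _ _ _ K A _ mT T0.
rewrite /fubini_F /fubini_G /= in E.
have mB : measurable_fun [set: R] (fun y => (tail D (x - y))%:E).
  apply/measurable_EFinP; apply: measurableT_comp; first exact: measurable_tail.
  exact: measurable_funB.
rewrite E EFinM EFin_sum_tail_int.
rewrite -(ge0_integralZl A measurableT mB) ?lee_fin//; last first.
  by move=> y _; rewrite lee_fin tail_ge0.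
apply: ge0_le_integral => //.
- by move=> y _; apply: integral_ge0 => a _; rewrite lee_fin tail_ge0.
- exact: (@measurable_fun_fubini_tonelli_G _ _ _ _ _ K _ mT T0).
- exact: emeasurable_funM.
- move=> a _.
  have -> : (\int[K]_y (tail B (x - y - a))%:E)%E = (sum_tail B K (x - a))%:E.
    by rewrite EFin_sum_tail_int; apply: eq_integral => y _; rewrite addrAC.
  by rewrite -EFinM lee_fin.
Qed.

End TailSum.

(** * Shifting the level of a sum when the shift bounds hold only for large arguments *)

Section LongTailSum.
Context {R : realType}.
Implicit Types A B : probability R R.

(* The three pieces [Y <= x - a], [X <= a] and [X > a, Y > x - a] cover the
   plane, and inside [X + Y > x] they are pairwise disjoint. *)
Lemma sum_tail_shift A B (C a t x : R) : 1 <= C -> a + a <= x ->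
  (forall z, a <= z -> tail A (z - t) <= C * tail A z) ->
  (forall z, a <= z -> tail B (z - t) <= C * tail B z) ->
  sum_tail A B (x - t) <= C * sum_tail A B x.
Proof.
move=> C1 ax hA hB.
have C0 : 0 <= C by apply: le_trans C1.
pose m : probability _ _ := (A \x B)%E.
pose I : set (R * R) := [set: R] `*` `]-oo, (x - a)]%classic.
pose J : set (R * R) := `]-oo, a]%classic `*` [set: R].
pose K : set (R * R) := `]a, +oo[%classic `*` `](x - a), +oo[%classic.
have mI : measurable I by exact: measurableX.
have mJ : measurable J by exact: measurableX.
have mK : measurable K by exact: measurableX.
have mE y : measurable (exceed (R := R) y) by exact: measurable_exceed.
have mEI y : measurable (exceed y `&` I) by exact: measurableI.
have mEJ y : measurable (exceed y `&` J) by exact: measurableI.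
(* On [I] the section starts at x - y >= a, in the range of [hA]; off [I] it is empty. The set [J]
   is symmetric. *)
have leI : (m (exceed (x - t) `&` I) <= C%:E * m (exceed x `&` I))%E.
  apply: le_product_measure_ysection => // y.
  have [yx|yx] := leP y (x - a); last first.
    rewrite (_ : ysection _ y = set0) ?measure0 ?mule_ge0// ?lee_fin//.
    apply/seteqP; split=> z //; rewrite /ysection/= inE /exceed /I /= in_itv/= => -[_ [_]]; lra.
  have E u : ysection (exceed u `&` I) y = `](u - y), +oo[%classic.
    rewrite -(ysection_exceed u y); apply/seteqP; split=> z; rewrite /ysection/= !inE /exceed /I /=; first by case.
    by move=> zu; split=> //; split => //=; rewrite in_itv.
  rewrite !E -!EFin_tail -EFinM lee_fin addrAC; apply: hA; lra.
have leJ : (m (exceed (x - t) `&` J) <= C%:E * m (exceed x `&` J))%E.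
  apply: le_product_measure_xsection => // y.
  have [yx|yx] := leP y a; last first.
    rewrite (_ : xsection _ y = set0) ?measure0 ?mule_ge0// ?lee_fin//.
    apply/seteqP; split=> z //; rewrite /xsection/= inE /exceed /J /= in_itv/= => -[_ [] /=]; lra.
  have E u : xsection (exceed u `&` J) y = `](u - y), +oo[%classic.
    rewrite -(xsection_exceed u y); apply/seteqP; split=> z; rewrite /xsection/= !inE /exceed /J /=; first by case.
    by move=> zu; split=> //; split => //=; rewrite in_itv.
  rewrite !E -!EFin_tail -EFinM lee_fin addrAC; apply: hB; lra.
(* [K] carries no condition on the sum, since u > a and v > x - a already give u + v > x; [1 <= C]
   pays for its weight. *)
have leK : (m K <= C%:E * m K)%E by rewrite lee_pemull// lee_fin.
rewrite -lee_fin EFinM !EFin_sum_tail.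
apply: (@le_trans _ _ (m (exceed (x - t) `&` I `|` exceed (x - t) `&` J `|` K))).
  apply: (le_measure m); rewrite ?inE//; first by do 2 apply: measurableU => //.
  move=> [u v] /= uv; rewrite /I /J /K /= !in_itv /= !andbT.
  by have [?|?] := leP v (x - a); [left; left|have [?|?] := leP u a; [left; right|right]].
apply: (le_trans (measureU2 m _ _)) => //; first exact: measurableU.
apply: (le_trans (leeD2r _ (measureU2 m _ _))) => //.
apply: (le_trans (leeD (leeD leI leJ) leK)).
have D (p q r : \bar R) : (0 <= p -> 0 <= q -> 0 <= r ->
    C%:E * p + C%:E * q + C%:E * r = C%:E * (p + q + r))%E.
  by move=> *; rewrite !ge0_muleDr ?adde_ge0.
rewrite D//; apply: lee_wpmul2l; first by rewrite lee_fin.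
rewrite -!(measureU m)//; first last.
- apply/seteqP; split=> -[u v]//=; rewrite /I /J /exceed /= !in_itv /=; lra.
- apply/seteqP; split=> -[u v]//=; rewrite /I /J /K /exceed /= !in_itv /= !andbT; lra.
- exact: measurableU.
apply: (le_measure m); rewrite ?inE//; first by do 2 apply: measurableU => //.
move=> [u v]/=; rewrite /I /J /K /exceed /= !in_itv /= !andbT; lra.
Qed.

End LongTailSum.

(** * The law of an independent pair, restricted to a further independent event *)

Section JointLaw.
Context {d : measure_display} {T : measurableType d} {R : realType}.
Variables (P : probability T R) (U V : {RV P >-> R}) (W : set T).
Hypothesis mW : measurable W.
Hypothesis UVW : forall A B : set R, measurable A -> measurable B ->
  P (U @^-1` A `&` V @^-1` B `&` W) = (P (U @^-1` A) * P (V @^-1` B) * P W)%E.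

Let mUV : measurable_fun [set: T] (fun w => (U w, V w)).
Proof. exact: measurable_fun_pair. Qed.

Let PW := NngNum (fine_ge0 (measure_ge0 P W)).

(** Scaling one marginal by [P W] turns the restricted law into a product of finite measures, so
    uniqueness of product measures applies. *)
Let lawU := mscale PW (distribution P U).

Let fin_lawU : fin_num_fun lawU.
Proof.
move=> A mA; rewrite /lawU /mscale/= fin_numM//.
exact: (fin_num_measure (distribution P U)).
Qed.

HB.instance Definition _ := Measure.on lawU.
HB.instance Definition _ := @Measure_isFinite.Build _ _ _ lawU fin_lawU.

Let law : {measure set (R * R) -> \bar R} :=
  measure_function_pushforward__canonical__measure_function_Measure (mrestr P mW) mUV.

(* The extra event [W] carries the summands not yet added. *)
Lemma joint_law (S : set (R * R)) : measurable S ->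
  P ((fun w => (U w, V w)) @^-1` S `&` W) =
  (P W * (distribution P U \x distribution P V) S)%E.
Proof.
move=> mS.
have finW : (fine (P W))%:E = P W by rewrite fineK// fin_num_measure.
transitivity ((lawU \x distribution P V)%E S).
  apply/esym; apply: (@product_measure_unique _ _ _ _ _ lawU (distribution P V) law) => // A B mA mB.
  transitivity (P (U @^-1` A `&` V @^-1` B `&` W)); first by [].
  transitivity ((fine (P W))%:E * P (U @^-1` A) * P (V @^-1` B))%E => //.
  by rewrite UVW// finW muleAC (muleC _ (P W)).
transitivity (\int[mscale PW (distribution P U)]_x (distribution P V \o xsection S) x)%E => //.
rewrite ge0_integral_mscale//; last first.
  by have := @measurable_fun_xsection _ _ _ _ _ (distribution P V) _ mS.
by rewrite /= finW.
Qed.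

End JointLaw.

(** * Sums of two independent variables *)

Section SumOfIndependent.
Context {d : measure_display} {T : measurableType d} {R : realType}.
Variable P : probability T R.
Implicit Types X Y : {RV P >-> R}.

Lemma independent_joint_law X Y (S : set (R * R)) : independent X Y -> measurable S ->
  P ((fun w => (X w, Y w)) @^-1` S) = (distribution P X \x distribution P Y)%E S.
Proof.
move=> XY mS.
have XY1 A B : measurable A -> measurable B ->
    P (X @^-1` A `&` Y @^-1` B `&` [set: T]) =
    (P (X @^-1` A) * P (Y @^-1` B) * P [set: T])%E.
  by move=> mA mB; rewrite setIT probability_setT mule1 XY.
have := joint_law measurableT XY1 mS.
by rewrite setIT probability_setT mul1e.
Qed.

Lemma tail_sum X Y : independent X Y -> forall x,
  tail (distribution P (X + Y : {RV P >-> R})) x =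
  sum_tail (distribution P X) (distribution P Y) x.
Proof.
move=> XY x; apply: EFin_inj; rewrite EFin_tail EFin_sum_tail.
rewrite -independent_joint_law//; last exact: measurable_exceed.
by congr (P _); apply/seteqP; split=> w /=; rewrite in_itv/= andbT.
Qed.

(** An event of X + Y is a planar event of the pair, and [joint_law] passes from rectangles to all
    planar events. *)
Lemma independent_sum X Y (W : set T) : measurable W ->
  (forall A B : set R, measurable A -> measurable B ->
    P (X @^-1` A `&` Y @^-1` B `&` W) = (P (X @^-1` A) * P (Y @^-1` B) * P W)%E) ->
  independent X Y -> forall A, measurable A ->
  P ((X + Y : {RV P >-> R}) @^-1` A `&` W) = (P ((X + Y : {RV P >-> R})%R @^-1` A) * P W)%E.
Proof.
move=> mW XYW XY A mA.
pose S := (fun z : R * R => z.1 + z.2) @^-1` A.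
have mS : measurable S.
  by rewrite -[S]setTI; apply: (measurable_funD measurable_fst measurable_snd).
have -> : (X + Y : {RV P >-> R}) @^-1` A = (fun w => (X w, Y w)) @^-1` S by [].
by rewrite (joint_law mW XYW mS) muleC independent_joint_law.
Qed.

End SumOfIndependent.

(** * Upper and lower limits as eventual bounds *)

Section LimSup.
Context {R : realType}.
Implicit Types (h : R -> \bar R) (c b : \bar R).

(** The strict gap matters: with [c = 1] it provides the contraction ratio of a positively
    decreasing tail. *)
Lemma near_le_of_limsup_lt h c : (limsup_pinfty h < c)%E ->
  exists2 b, (b < c)%E & \forall x \near +oo, (h x <= b)%E.
Proof.
rewrite /limsup_pinfty limf_esupE => /ereal_inf_lt[_ [V nV <-] Vc].
exists (ereal_sup [set h x | x in V]) => //.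
by apply: filterS nV => x Vx; apply: ereal_sup_ubound; exists x.
Qed.

Lemma limsup_le_of_near h b : (\forall x \near +oo, (h x <= b)%E) ->
  (limsup_pinfty h <= b)%E.
Proof.
move=> nb; rewrite /limsup_pinfty limf_esupE.
apply: ge_ereal_inf; exists (ereal_sup [set h x | x in [set x | (h x <= b)%E]]); first by eexists; [exact: nb|].
by apply: ge_ereal_sup => _ [x /= hx <-].
Qed.

Lemma near_ge_of_liminf_gt h c : (c < liminf_pinfty h)%E ->
  exists2 b, (c < b)%E & \forall x \near +oo, (b <= h x)%E.
Proof.
rewrite /liminf_pinfty /limf_einf lteNr => /near_le_of_limsup_lt[b bc nb].
exists (- b)%E; first by rewrite lteNr.
by apply: filterS nb => x; rewrite leeNl.
Qed.

Lemma limsup_ltyP (k : R -> R) :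
  (limsup_pinfty (fun x => (k x)%:E) < +oo)%E <->
  exists2 C : R, 0 < C & \forall x \near +oo, k x <= C.
Proof.
split=> [/near_le_of_limsup_lt[[r| |]// _ nb]|[C C0 nC]].
- exists (Num.max 1 r); first by rewrite lt_max ltr01.
  by apply: filterS nb => x; rewrite lee_fin le_max orbC => ->.
- exists 1 => //; apply: filterS nb => x; by rewrite leeNy_eq.
- apply: (@le_lt_trans _ _ C%:E); last by rewrite ltry.
  by apply: limsup_le_of_near; apply: filterS nC => x; rewrite lee_fin.
Qed.

End LimSup.

Section Near.
Context {R : realType}.

(** A positive threshold stays passed when the argument is multiplied by a factor at least 1. *)
Lemma near_pinftyP (Q : R -> Prop) :
  (\forall x \near +oo, Q x) <-> exists2 M : R, 0 < M & forall x, M <= x -> Q x.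
Proof.
split=> [[M [_ MQ]]|[M M0 MQ]].
- exists (Num.max M 0 + 1) => [|x xM].
    by rewrite ltr_pwDr// le_max lexx orbT.
  by apply: MQ; apply: lt_le_trans xM; rewrite ltr_pwDr// le_max lexx.
- by exists M; split; [exact: num_real|move=> x /ltW; exact: MQ].
Qed.

End Near.

(** * Positive decrease with arbitrarily small ratio *)

Section Decay.
Context {R : realType}.
Implicit Types (s t : R -> R) (A B F H : probability R R).

(** Unlike a single ratio below 1, an arbitrary [e] absorbs multiplicative constants. Stated for
    functions, so that it applies to a sum of two tails. *)
Definition decays t : Prop := forall e : R, 0 < e ->
  exists2 v : R, 1 < v & \forall x \near +oo, t (v * x) <= e * t x.

Lemma exists_expr_le (r e : R) : 0 <= r < 1 -> 0 < e -> exists k, r ^+ k <= e.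
Proof.
move=> /andP[r0 r1] e0.
have /cvgrPdist_le/(_ e e0)[k _ /(_ k (leqnn k))] : r ^+ n @[n --> \oo] --> (0 : R).
  by apply: cvg_expr; rewrite ger0_norm.
by rewrite /= sub0r normrN ger0_norm ?exprn_ge0// => ?; exists k.
Qed.

(** Iterating a bound with ratio r < 1 at v gives ratio r^n at v^n, below any [e] for large n.
    Conversely, [e] = 1/2 suffices. *)
Lemma class_PD_decays A : tail_pos A -> (class_PD A <-> decays (tail A)).
Proof.
move=> A0; have tA x : 0 < tail A x by exact: tail_gt0.
split=> [[v v1 /near_le_of_limsup_lt[b b1 nb]] e e0|dA]; last first.
  have [|v v1 nv] := dA (2^-1); first by rewrite invr_gt0.
  exists v => //; apply: (@le_lt_trans _ _ (2^-1)%:E); last by rewrite lte_fin; lra.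
  apply: limsup_le_of_near; apply: filterS nv => x.
  by rewrite lee_fin ler_pdivrMr.
have [r /andP[r0 r1] nr] : exists2 r : R, 0 <= r < 1 &
    \forall x \near +oo, tail A (v * x) <= r * tail A x.
  (* Truncation at 0 makes the bound a legitimate base for powers, even if [b] is negative or
     -oo. *)
  exists (Num.max (fine b) 0).
    rewrite le_max lexx orbT /= gt_max ltr01 andbT.
    by case: b b1 {nb} => [b| |]//=; rewrite ?lte_fin.
  apply: filterS nb => x; rewrite -ler_pdivrMr//.
  case: b b1 => [b| |]//= _.
  by rewrite lee_fin le_max => ->.
have /near_pinftyP[M M0 HM] := nr.
have [k rk] : exists k, r ^+ k <= e by apply: exists_expr_le => //; rewrite r0.
(* The successor keeps the dilation above 1 when [k] is 0; the extra factor r only helps. *)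
exists (v ^+ k.+1); first by rewrite exprn_egt1.
apply/near_pinftyP; exists M => // x Mx.
have v0 : 0 < v by lra.
have IH n : tail A (v ^+ n * x) <= r ^+ n * tail A x.
  elim: n => [|n IH]; first by rewrite !expr0 !mul1r.
  rewrite !exprS -!mulrA.
  apply: le_trans (HM _ _) _; last by rewrite ler_wpM2l.
  apply: (le_trans Mx); apply: ler_peMl; first by lra.
  by apply: exprn_ege1; exact: ltW.
apply: le_trans (IH _) _; rewrite ler_wpM2r ?tail_ge0//.
by apply: le_trans rk; rewrite exprS; apply: ler_piMl; [exact: exprn_ge0|exact: ltW].
Qed.

(** The two comparisons cost C each, paid for by taking [e / C / C] for [t]; the dilation [w] is
    absorbed into the new factor [w * v]. *)
Lemma decays_transfer s t (w C : R) : 1 <= w -> 0 < C -> decays t ->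
  (\forall x \near +oo, s (w * x) <= C * t x) ->
  (\forall x \near +oo, t x <= C * s x) -> decays s.
Proof.
move=> w1 C0 dt /near_pinftyP[M M0 HM] /near_pinftyP[N N0 HN] e e0.
have [|v v1 /near_pinftyP[K K0 HK]] := dt (e / C / C); first by rewrite !divr_gt0.
exists (w * v); first by rewrite -[1]mul1r; nra.
apply/near_pinftyP; exists (M + N + K) => [|x x1]; first by rewrite !addr_gt0.
have h1 := HM (v * x) (ltac:(nra)); have h2 := HK x (ltac:(lra)).
have h3 := HN x (ltac:(lra)); rewrite mulrA in h1.
have -> : e * s x = C * (e / C / C * (C * s x)) by field; rewrite gt_eqF.
apply: (le_trans h1); rewrite ler_pM2l//; apply: (le_trans h2).
by rewrite ler_pM2l// !divr_gt0.
Qed.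

(** By monotonicity the larger of the two dilations serves both functions. *)
Lemma decaysD s t : (forall x, 0 <= s x) -> (forall x, 0 <= t x) ->
  {homo s : x y /~ x <= y} -> {homo t : x y /~ x <= y} ->
  decays s -> decays t -> decays (fun x => s x + t x).
Proof.
move=> s0 t0 hs ht ds dt e e0.
have [v v1 /near_pinftyP[M M0 HM]] := ds e e0.
have [w w1 /near_pinftyP[N N0 HN]] := dt e e0.
exists (Num.max v w); first by rewrite lt_max v1.
apply/near_pinftyP; exists (M + N) => [|x x1]; first exact: addr_gt0.
rewrite mulrDr lerD//.
- by apply: le_trans (HM x _); [apply: hs; rewrite ler_wpM2r ?le_max ?lexx//|]; lra.
- by apply: le_trans (HN x _); [apply: ht; rewrite ler_wpM2r ?le_max ?lexx ?orbT//|]; lra.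
Qed.

End Decay.

(** * Comparison of tails up to a constant *)

Section Domination.
Context {R : realType}.
Implicit Types (s t : R -> R) (A B F G H : probability R R).

(** A big-O relation on the whole line, so that it can be integrated against a law. *)
Definition dominated s t : Prop := exists2 C : R, 0 < C & forall x, s x <= C * t x.

Lemma dominated_trans s t u : dominated s t -> dominated t u -> dominated s u.
Proof.
move=> [C C0 h] [D D0 k]; exists (C * D) => [|x]; first exact: mulr_gt0.
by apply: le_trans (h x) _; rewrite -mulrA ler_pM2l.
Qed.

(** Left of the threshold M, s <= 1 while the tail of A is at least its positive value at M, whose
    inverse is an admissible constant there. *)
Lemma dominated_near s A (C : R) : tail_pos A -> (forall x, s x <= 1) ->
  (\forall x \near +oo, s x <= C * tail A x) -> dominated s (tail A).
Proof.
move=> A0 s1 /near_pinftyP[M M0 HM]; have tA x : 0 < tail A x by exact: tail_gt0.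
have C1 : 0 < Num.max C (tail A M)^-1 by rewrite lt_max invr_gt0 tA orbT.
exists (Num.max C (tail A M)^-1) => // x.
have [Mx|xM] := leP M x.
  by apply: le_trans (HM x Mx) _; rewrite ler_wpM2r ?tail_ge0// le_max lexx.
apply: le_trans (s1 x) _; apply: (@le_trans _ _ ((tail A M)^-1 * tail A x)).
  by rewrite ler_pdivlMl// mulr1 le_tail// ltW.
by rewrite ler_wpM2r ?tail_ge0// le_max lexx orbT.
Qed.

Lemma sum_tail_le1 A B x : sum_tail A B x <= 1.
Proof.
rewrite -lee_fin EFin_sum_tail.
by apply: (probability_le1 ((A \x B)%E : probability _ _)); exact: measurable_exceed.
Qed.

Lemma class_OSP A : tail_pos A -> class_OS A <-> dominated (sum_tail A A) (tail A).
Proof.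
move=> A0; have tA x : 0 < tail A x by exact: tail_gt0.
rewrite /class_OS; under eq_fun do rewrite tail_convolution.
split=> [/limsup_ltyP[C C0 nC]|[C C0 h]].
  apply: (@dominated_near _ _ C) => //; first exact: sum_tail_le1.
  by apply: filterS nC => x; rewrite ler_pdivrMr.
by apply/limsup_ltyP; exists C => //; apply: nearW => x; rewrite ler_pdivrMr.
Qed.

(** Replace A by F, commute, replace B by F; what remains is F * F, controlled by OS. *)
Lemma dominated_sum A B F : tail_pos F -> class_OS F ->
  dominated (tail A) (tail F) -> dominated (tail B) (tail F) ->
  dominated (sum_tail A B) (tail F).
Proof.
move=> F0 /(class_OSP F0) FF [C C0 hA] [D D0 hB].
apply: dominated_trans FF; exists (C * D) => [|x]; first exact: mulr_gt0.
apply: (@le_trans _ _ (C * sum_tail F B x)).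
  by apply: le_sum_tail => [|y]; [exact: ltW|exact: hA].
rewrite -mulrA ler_pM2l// sum_tailC.
by apply: le_sum_tail => [|y]; [exact: ltW|exact: hB].
Qed.

Lemma class_OS_equiv F H : tail_pos F -> tail_pos H ->
  dominated (tail H) (tail F) -> dominated (tail F) (tail H) ->
  class_OS F -> class_OS H.
Proof.
move=> F0 H0 HF FH OSF; apply/class_OSP => //.
exact: dominated_trans (dominated_sum F0 OSF HF HF) FH.
Qed.

Lemma class_PD_equiv F H : tail_pos F -> tail_pos H ->
  dominated (tail H) (tail F) -> dominated (tail F) (tail H) ->
  class_PD F -> class_PD H.
Proof.
move=> F0 H0 [C C0 hC] [D D0 hD] /(class_PD_decays F0) dF.
apply/(class_PD_decays H0).
apply: (decays_transfer (w := 1) (C := Num.max C D) _ _ dF) => //.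
- by rewrite lt_max C0.
- apply: nearW => x; rewrite mul1r; apply: le_trans (hC x) _.
  by rewrite ler_wpM2r ?tail_ge0// le_max lexx.
- apply: nearW => x; apply: le_trans (hD x) _.
  by rewrite ler_wpM2r ?tail_ge0// le_max lexx orbT.
Qed.

Lemma class_OLP A : tail_pos A ->
  class_OL A <-> forall t : R, dominated (fun x => tail A (x - t)) (tail A).
Proof.
move=> A0; have tA x : 0 < tail A x by exact: tail_gt0.
split=> [OL t|h t _].
  have [->|t0] := eqVneq t 0; first by exists 1 => // x; rewrite subr0 mul1r.
  have /limsup_ltyP[C C0 nC] := OL t t0.
  apply: (@dominated_near _ _ C) => // [x|]; first exact: tail_le1.
  by apply: filterS nC => x; rewrite ler_pdivrMr.
have [C C0 hC] := h t; apply/limsup_ltyP; exists C => //.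
by apply: nearW => x; rewrite ler_pdivrMr.
Qed.

(** For t > 0 monotonicity gives the other inequality. A negative shift is the inverse ratio of a
    positive one taken at x - y, and 1 / (1 + e) >= 1 - e. *)
Lemma class_LP A : tail_pos A -> class_L A <->
  forall t e : R, 0 < t -> 0 < e -> \forall x \near +oo, tail A (x - t) <= (1 + e) * tail A x.
Proof.
move=> A0; have tA x : 0 < tail A x by exact: tail_gt0.
split=> [L t e t0 e0|h y y0].
  have /cvgrPdist_le/(_ e e0) := L t (lt0r_neq0 t0).
  by apply: filterS => x; rewrite distrC ler_norml -ler_pdivrMr// => /andP[_]; lra.
apply/cvgrPdist_le => e e0.
have [ylt0|ygt0|/eqP] := ltgtP y 0; last by rewrite (negbTE y0).
  have /near_pinftyP[M M0 HM] := h (- y) e (ltac:(lra)) e0.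
  apply/near_pinftyP; exists M => // x Mx.
  have := HM (x - y) (ltac:(lra)); rewrite opprK subrK => hx.
  have le1 : tail A (x - y) / tail A x <= 1.
    by rewrite ler_pdivrMr// mul1r le_tail//; lra.
  rewrite ger0_norm ?subr_ge0// lerBlDr -lerBlDl ler_pdivlMr//.
  have := tA x; have := tA (x - y); nra.
apply: filterS (h y e ygt0 e0) => x; rewrite -ler_pdivrMr// => hx.
have ge1 : 1 <= tail A (x - y) / tail A x.
  by rewrite ler_pdivlMr// mul1r le_tail//; lra.
by rewrite distrC ger0_norm ?subr_ge0//; lra.
Qed.

End Domination.

(** * Closure of the classes under independent sums *)

Section SumClasses.
Context {R : realType}.
Variables F G H : probability R R.
Hypotheses (F0 : tail_pos F) (G0 : tail_pos G).
Hypothesis HFG : forall x, tail H x = sum_tail F G x.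

Lemma sum_tail_pos : tail_pos H.
Proof.
move=> x _; rewrite HFG; apply: lt_le_trans (sum_tail_ge F G x).
by rewrite mulr_gt0// tail_gt0.
Qed.

Lemma dominated_suml : dominated (tail F) (tail H).
Proof.
have g0 : 0 < tail G 0 by exact: tail_gt0.
exists (tail G 0)^-1 => [|x]; first by rewrite invr_gt0.
by rewrite ler_pdivlMl// mulrC HFG sum_tail_ge.
Qed.

Lemma dominated_sumr : dominated (tail G) (tail H).
Proof.
have f0 : 0 < tail F 0 by exact: tail_gt0.
exists (tail F 0)^-1 => [|x]; first by rewrite invr_gt0.
by rewrite ler_pdivlMl// mulrC HFG sum_tailC sum_tail_ge.
Qed.

Lemma class_PD_sum_dominated : dominated (tail G) (tail F) -> class_PD F -> class_PD H.
Proof.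
move=> [C C0 hC] /(class_PD_decays F0) dF; apply/(class_PD_decays sum_tail_pos).
have [D D0 hD] := dominated_suml.
(* One constant for both comparisons: H(2x) <= (1 + C) F(x) and F(x) <= D H(x). *)
apply: (decays_transfer (w := 2) (C := 1 + C + D) _ _ dF) => //.
- by rewrite ler1n.
- by rewrite !addr_gt0.
- apply: nearW => x; rewrite mulr_natl mulr2n HFG; apply: le_trans (sum_tail_le _ _ _ _) _.
  have := hC x; have := tail_ge0 F x; nra.
- apply: nearW => x; apply: le_trans (hD x) _; rewrite ler_wpM2r ?tail_ge0//; lra.
Qed.

(** Here H is compared with the sum of the two tails, which decays by [decaysD]. *)
Lemma class_PD_sum : class_PD F -> class_PD G -> class_PD H.
Proof.
move=> /(class_PD_decays F0) dF /(class_PD_decays G0) dG.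
apply/(class_PD_decays sum_tail_pos).
have [C C0 hC] := dominated_suml; have [D D0 hD] := dominated_sumr.
have dFG := decaysD (tail_ge0 F) (tail_ge0 G) (fun x y => @le_tail _ F y x)
  (fun x y => @le_tail _ G y x) dF dG.
apply: (decays_transfer (w := 2) (C := 1 + C + D) _ _ dFG) => //.
- by rewrite ler1n.
- by rewrite !addr_gt0.
- apply: nearW => x; rewrite mulr_natl mulr2n HFG; apply: le_trans (sum_tail_le _ _ _ _) _.
  have := tail_ge0 F x; have := tail_ge0 G x; nra.
- apply: nearW => x; have := hC x; have := hD x; have := tail_ge0 H x; nra.
Qed.

(** The first summand alone bears the shift: condition on the second one. *)
Lemma class_OL_sum : class_OL F -> class_OL H.
Proof.
move=> /(class_OLP F0) OLF; apply/(class_OLP sum_tail_pos) => t.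
have [C C0 hC] := OLF t; exists C => // x; rewrite !HFG.
by apply: le_sum_tail => [|y]; [exact: ltW|rewrite addrAC].
Qed.

Lemma class_OS_sum : class_OS F -> class_OS G -> class_OS H.
Proof.
move=> /(class_OSP F0)[C C0 hC] /(class_OSP G0)[D D0 hD].
apply/(class_OSP sum_tail_pos).
have HGF x : tail H x = sum_tail G F x by rewrite HFG sum_tailC.
have HG x : sum_tail H G x <= D * tail H x.
  by rewrite HGF; apply: (sum_tail_absorb x (ltW D0) HFG).
have HF x : sum_tail H F x <= C * tail H x.
  by rewrite HFG; apply: (sum_tail_absorb x (ltW C0) HGF).
exists (D * C) => [|x]; first exact: mulr_gt0.
(* H * H = F * (G * H), and G * H <= D H is known, which leaves H * F. *)
apply: (@le_trans _ _ (D * sum_tail H F x)); last by rewrite -mulrA ler_pM2l.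
by apply: (sum_tail_absorb x (ltW D0) HFG) => y; rewrite sum_tailC.
Qed.

Lemma class_L_sum : class_L F -> class_L G -> class_L H.
Proof.
move=> /(class_LP F0) LF /(class_LP G0) LG; apply/(class_LP sum_tail_pos) => t e t0 e0.
have /near_pinftyP[M M0 HM] := LF t e t0 e0.
have /near_pinftyP[N N0 HN] := LG t e t0 e0.
apply/near_pinftyP; exists (M + N + (M + N)) => [|x hx]; first by rewrite !addr_gt0.
rewrite !HFG; apply: (sum_tail_shift (a := M + N)) => //; first by lra.
- by move=> z hz; apply: HM; lra.
- by move=> z hz; apply: HN; lra.
Qed.

End SumClasses.

(** * From the lower Matuszewska index to power bounds on the tail *)

Section Matuszewska.
Context {R : realType}.
Implicit Types F G : probability R R.

Lemma tail_star_lt_of_index G (q : R) : (q%:E < lower_Matuszewska G)%E ->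
  exists2 v : R, 1 < v & (tail_star G v < (v `^ (- q))%:E)%E.
Proof.
move=> /ereal_sup_gt[_ [v /= v1 <-] qv]; exists v => //.
have lv : 0 < ln v by exact: ln_gt0.
have v0 : 0 < v by lra.
case: (tail_star G v) qv => [r| |]//=; last by rewrite ltNyr.
  (* For r <= 0 the value of [lne] is -oo, and the claim is just positivity of the power. *)
  case: ifPn => [r0 _|]; first by rewrite lte_fin (le_lt_trans r0)// powR_gt0.
  rewrite -ltNge => r0; rewrite -EFinN -EFinM !lte_fin ltr_pdivlMr// => qr.
  rewrite -ltr_ln ?posrE ?powR_gt0// ln_powR; lra.
by rewrite gt0_mulNye// lte_fin invr_gt0.
Qed.

(** Beyond M, multiplying x by v does not increase x^q G(x). Repeated division by v brings any x >=
    M into [M, vM], where (vM)^q is a bound. *)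
Lemma powR_tail_bounded G (q : R) : tail_pos G -> 0 <= q ->
  (q%:E < lower_Matuszewska G)%E ->
  exists2 C : R, 0 < C & \forall x \near +oo, x `^ q * tail G x <= C.
Proof.
move=> G0 q0 /tail_star_lt_of_index[v v1 /near_le_of_limsup_lt[b bv nb]].
have tG x : 0 < tail G x by exact: tail_gt0.
have v0 : 0 < v by lra.
have /near_pinftyP[M M0 HM] : \forall x \near +oo, (v * x) `^ q * tail G (v * x) <= x `^ q * tail G x.
  near=> x; have x0 : 0 < x by near: x; exact: nbhs_pinfty_gt.
  rewrite powRM ?(ltW x0) ?(ltW v0)// (mulrC (v `^ q)) -mulrA ler_wpM2l ?powR_ge0//.
  have : ((tail G (v * x) / tail G x)%:E <= (v `^ (- q))%:E)%E.
    by apply: le_trans (ltW bv); near: x.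
  by rewrite lee_fin ler_pdivrMr// powRN ler_pdivlMl ?powR_gt0.
exists ((v * M) `^ q); first by rewrite powR_gt0// mulr_gt0.
apply/near_pinftyP; exists M => //.
have base x : M <= x -> x <= v * M -> x `^ q * tail G x <= (v * M) `^ q.
  move=> Mx xv; rewrite -[leRHS]mulr1 ler_pM ?powR_ge0 ?tail_ge0 ?tail_le1//.
  by rewrite ge0_ler_powR// ?nnegrE; lra.
have step n x : M <= x -> x <= v ^+ n * (v * M) -> x `^ q * tail G x <= (v * M) `^ q.
  elim: n x => [|n IH] x Mx; first by rewrite expr0 mul1r; exact: base.
  rewrite exprS -mulrA => xn; have [/base->//|vx] := leP x (v * M).
  have xE : x = v * (x / v) by rewrite mulrC divfK ?gt_eqF.
  have Mxv : M <= x / v by rewrite ler_pdivlMr// mulrC ltW.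
  rewrite xE; apply: (le_trans (HM _ Mxv)); apply: IH => //.
  by rewrite ler_pdivrMr// mulrC.
move=> x Mx; have x0 : 0 < x by lra.
(* [k] is chosen so that x <= v^k (vM). *)
have [||k hk] := @exists_expr_le _ v^-1 (v * M / x).
- by rewrite invr_ge0 (ltW v0)/= invf_lt1.
- by rewrite divr_gt0// mulr_gt0.
apply: (step k) => //; move: hk; rewrite exprVn.
by rewrite ler_pdivlMr// ler_pdivrMl ?exprn_gt0.
Unshelve. all: by end_near.
Qed.

Lemma dominated_of_index F G (q : R) : tail_pos F -> tail_pos G -> 0 <= q ->
  (q%:E < lower_Matuszewska G)%E ->
  (0 < liminf_pinfty (fun x => (x `^ q * tail F x)%:E))%E ->
  dominated (tail G) (tail F).
Proof.
move=> F0 G0 q0 qG /near_ge_of_liminf_gt[b b0 nb].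
have [C C0 nC] := powR_tail_bounded G0 q0 qG.
have [c c0 nc] : exists2 c : R, 0 < c & \forall x \near +oo, c <= x `^ q * tail F x.
  case: b b0 nb => [r r0 nr|_ ny|//]; first by exists r.
  (* A bound +oo cannot hold for real values, so any positive constant will do. *)
  by exists 1 => //; apply: filterS ny => x; rewrite leye_eq.
apply: (@dominated_near _ _ _ (C / c)) => // [x|]; first exact: tail_le1.
near=> x; have x0 : 0 < x `^ q by rewrite powR_gt0//; near: x; exact: nbhs_pinfty_gt.
have h1 : x `^ q * tail G x <= C by near: x.
have h2 : c <= x `^ q * tail F x by near: x.
rewrite -(ler_pM2l x0); apply: (le_trans h1).
by rewrite mulrCA -mulrA ler_pMr// mulrC ler_pdivlMr// mul1r.
Unshelve. all: by end_near.
Qed.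

End Matuszewska.

(** * Finite sums of mutually independent variables *)

Section FiniteSums.
Context {d : measure_display} {T : measurableType d} {R : realType}.
Variables (P : probability T R) (I : finType) (X : I -> {RV P >-> R}).
Hypothesis indX : mutually_independent X.

Let S (s : seq I) : {RV P >-> R} := \sum_(i <- s) X i.

Let cyl (J : {set I}) (B : I -> set R) := \bigcap_(i in [set` J]) (X i @^-1` B i).

Let measurable_cyl J B : (forall i, measurable (B i)) -> measurable (cyl J B).
Proof.
move=> mB; apply: fin_bigcap_measurable => // i _.
by rewrite -[X in measurable X]setTI; exact: measurable_funP.
Qed.

(** A condition on a new coordinate yields a larger cylinder, to which mutual independence applies
    directly. *)
Let cyl_setU1 (i : I) (J : {set I}) (A : set R) (B : I -> set R) : i \notin J ->
  (forall i, measurable (B i)) -> measurable A ->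
  let B' j := if j == i then A else B j in
  (forall j, measurable (B' j)) /\ X i @^-1` A `&` cyl J B = cyl (i |: J) B' /\
  P (cyl (i |: J) B') = (P (X i @^-1` A) * P (cyl J B))%E.
Proof.
move=> iJ mB mA B'.
have mB' j : measurable (B' j) by rewrite /B'; case: ifP.
have B'J j : j \in J -> B' j = B j.
  by rewrite /B'; case: eqP => // ->; rewrite (negbTE iJ).
split=> //; split.
  apply/seteqP; split=> w.
    move=> [Xi h] j /=; rewrite in_setU1 /B'; case: eqP => [-> _ //|_ /= jJ].
    exact: h.
  move=> h; split.
    by have := h i; rewrite /= /B' eqxx; apply; rewrite setU11.
  by move=> j /= jJ; have := h j; rewrite /= B'J//; apply; rewrite in_setU1 jJ orbT.
rewrite /cyl !indX// big_setU1//= {1}/B' eqxx; congr (_ * _)%E.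
by apply: eq_bigr => j jJ; rewrite B'J.
Qed.

Let cyl0 B : cyl finset.set0 B = [set: T].
Proof. by apply/seteqP; split=> // w _ j /=; rewrite inE. Qed.

(* Independence from all remaining variables jointly, the invariant that makes
   the induction on [s] go through. *)
Let splits s := forall (J : {set I}) (A : set R) (B : I -> set R),
  {in s, forall i, i \notin J} -> measurable A -> (forall i, measurable (B i)) ->
  P (S s @^-1` A `&` cyl J B) = (P (S s @^-1` A) * P (cyl J B))%E.

(** Move the event of [X i] into the cylinder, then split off the partial sum. This is the rectangle
    hypothesis of [independent_sum]. *)
Let splits_pair i s (J : {set I}) (C : I -> set R) : splits s -> i \notin s ->
  i \notin J -> {in s, forall j, j \notin J} -> (forall j, measurable (C j)) ->
  forall A B : set R, measurable A -> measurable B ->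
  P (X i @^-1` A `&` S s @^-1` B `&` cyl J C) =
  (P (X i @^-1` A) * P (S s @^-1` B) * P (cyl J C))%E.
Proof.
move=> ss iNs iJ sJ mC A B mA mB.
have [mC' [E1 E2]] := cyl_setU1 iJ mC mA.
rewrite (setIC (X i @^-1` _)) -setIA E1 ss// ?E2 ?muleA ?(muleC (P (S s @^-1` _)))//.
move=> j js; rewrite in_setU1 negb_or sJ// andbT.
by apply: contraNneq iNs => <-.
Qed.

Let splits_independent i s : splits s -> i \notin s -> independent (X i) (S s).
Proof.
move=> ss iNs A B mA mB.
have := @splits_pair i s finset.set0 (fun=> setT) ss iNs _ _ _ A B mA mB.
rewrite cyl0 setIT probability_setT mule1; apply => //; first by rewrite inE.
by move=> j _; rewrite inE.
Qed.

Let splits_uniq s : uniq s -> splits s.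
Proof.
elim: s => [|i s IH] /= us J A B sJ mA mB.
  rewrite /S big_nil.
  (* The empty sum is the constant 0, so its events are trivial. *)
  have [A0|A0] := pselect (A 0).
    have -> : (0 : {RV P >-> R}) @^-1` A = setT by apply/seteqP; split.
    by rewrite setTI probability_setT mul1e.
  have -> : (0 : {RV P >-> R}) @^-1` A = set0 by apply/seteqP; split.
  by rewrite set0I measure0 mul0e.
have /andP[iNs {}/IH ss] := us.
rewrite /S big_cons -/(S s); apply: independent_sum => //.
- exact: measurable_cyl.
- apply: splits_pair => //; first by apply: sJ; rewrite mem_head.
  by move=> j js; apply: sJ; rewrite in_cons js orbT.
- exact: splits_independent.
Qed.

Lemma independent_sum_seq i s : uniq (i :: s) ->
  independent (X i) (\sum_(j <- s) X j : {RV P >-> R}).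
Proof. by move=> /= /andP[iNs us]; apply: splits_independent => //; exact: splits_uniq. Qed.

(** [dominated_sum] adds one summand at a time, starting from the empty sum, whose tail vanishes at
    positive levels. *)
Lemma dominated_tail_sum_seq (F : probability R R) : tail_pos F -> class_OS F ->
  (forall i, dominated (tail (distribution P (X i))) (tail F)) ->
  forall s, uniq s ->
  dominated (tail (distribution P (\sum_(i <- s) X i : {RV P >-> R}))) (tail F).
Proof.
move=> F0 OSF XF; elim=> [|i s IH] us.
  rewrite big_nil; apply: (@dominated_near _ _ _ 1) => // [x|]; first exact: tail_le1.
  apply/near_pinftyP; exists 1 => // x x1.
  have -> : tail (distribution P (0 : {RV P >-> R})) x = 0.
    apply: EFin_inj; rewrite EFin_tail; transitivity (P set0); last by rewrite measure0.
    congr (P _); apply/seteqP; split=> w //=; rewrite in_itv/= andbT.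
    by move=> x0; have : x < 0 by []; lra.
  by rewrite mul1r tail_ge0.
have [C C0 hC] : dominated (sum_tail (distribution P (X i))
    (distribution P (\sum_(j <- s) X j : {RV P >-> R}))) (tail F).
  have /andP[_ us'] := us.
  exact: (dominated_sum F0 OSF (XF i) (IH us')).
exists C => // x; rewrite big_cons tail_sum//; exact: independent_sum_seq.
Qed.

(** Each summand stays dominated as others are added. The induction starts at one summand and
    carries positivity of the tail along. *)
Lemma tail_sum_seq_ge : (forall i, tail_pos (distribution P (X i))) ->
  forall s, uniq s -> s != [::] ->
  tail_pos (distribution P (\sum_(i <- s) X i : {RV P >-> R})) /\
  {in s, forall i, dominated (tail (distribution P (X i)))
     (tail (distribution P (\sum_(i <- s) X i : {RV P >-> R})))}.
Proof.
move=> X0; elim=> [//|i [|j s] IH] us _.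
  rewrite big_cons big_nil addr0; split=> // k; rewrite inE => /eqP ->.
  by exists 1 => // x; rewrite mul1r.
have {IH} [S0 IH] := IH (ltac:(by case/andP: us)) isT.
have E := tail_sum (independent_sum_seq us).
rewrite (big_cons _ _ i); split; first exact: (sum_tail_pos (X0 i) S0 E).
move=> k; rewrite (in_cons i) => /orP[/eqP ->|/IH ks].
  exact: (dominated_suml S0 E).
exact: dominated_trans ks (dominated_sumr (X0 i) E).
Qed.

End FiniteSums.

(** * Limit hypotheses turned into domination *)

Section LimitComparison.
Context {R : realType}.
Implicit Types F G : probability R R.

Lemma dominated_of_littleo F G : tail_pos F ->
  tail G x / tail F x @[x --> +oo] --> (0 : R) -> dominated (tail G) (tail F).
Proof.
move=> F0 /cvgrPdist_le/(_ 1 ltr01) h.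
apply: (@dominated_near _ _ _ 1) => // [x|]; first exact: tail_le1.
apply: filterS h => x; rewrite sub0r normrN => /(le_trans (ler_norm _)).
by rewrite ler_pdivrMr// tail_gt0.
Qed.

Lemma dominated_of_limsup_sup (I : Type) (F : I -> probability R R) (i0 i : I) :
  tail_pos (F i0) ->
  (limsup_pinfty (fun x =>
     ereal_sup (range (fun l => (tail (F l) x / tail (F i0) x)%:E))) < +oo)%E ->
  dominated (tail (F i)) (tail (F i0)).
Proof.
move=> F0 h; have /limsup_ltyP[C C0 nC] :
    (limsup_pinfty (fun x => (tail (F i) x / tail (F i0) x)%:E) < +oo)%E.
  have [b boo nb] := near_le_of_limsup_lt h.
  apply: le_lt_trans boo; apply: limsup_le_of_near; apply: filterS nb => x.
  by apply: le_trans; apply: ereal_sup_ubound; exists i.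
apply: (@dominated_near _ _ _ C) => // [x|]; first exact: tail_le1.
by apply: filterS nC => x; rewrite ler_pdivrMr// tail_gt0.
Qed.

End LimitComparison.

Theorem theorem2p3 (R : realType) (d : measure_display) (T : measurableType d)
    (P : probability T R) :
  (* 1 *)
  (forall X Y : {RV P >-> R}, independent X Y ->
    let F := distribution P X in
    let G := distribution P Y in
    let FG := distribution P (X + Y : {RV P >-> R}) in
    tail_pos F -> tail_pos G ->
    has_support F [set: R] -> has_support G [set: R] ->
    (class_PD F -> tail G x / tail F x @[x --> +oo] --> (0 : R) -> class_OL G -> class_PD FG) /\
    (class_OT F -> tail G x / tail F x @[x --> +oo] --> (0 : R) -> class_OL G -> class_OT FG)) /\
  (* 2 *)
  (forall X Y : {RV P >-> R}, independent X Y ->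
    let F := distribution P X in
    let G := distribution P Y in
    let FG := distribution P (X + Y : {RV P >-> R}) in
    tail_pos F -> tail_pos G ->
    has_support F `[0, +oo[%classic -> has_support G `[0, +oo[%classic ->
    forall f g : R -> R, has_density F f -> has_density G g ->
    bounded_increase f ->
    (0 < lower_Matuszewska F)%E ->
    (lower_Matuszewska F < lower_Matuszewska G)%E ->
    (exists q : R,
      [/\ (lower_Matuszewska F <= q%:E)%E, (q%:E < lower_Matuszewska G)%E &
          (0 < liminf_pinfty (fun x => (x `^ q * tail F x)%:E))%E]) ->
    (class_OA F -> class_OA G -> class_OA FG) /\
    (class_OT F -> class_OT G -> class_OT FG)) /\
  (* 3: the n.+2 >= 2 summands are indexed by 'I_n.+2, F_1 being F ord0 *)
  (forall (n : nat) (X : 'I_n.+2 -> {RV P >-> R}), mutually_independent X ->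
    let F i := distribution P (X i) in
    let FS := distribution P (\sum_(i < n.+2) X i : {RV P >-> R}) in
    (forall i, tail_pos (F i)) ->
    (forall i, has_support (F i) `[0, +oo[%classic) ->
    class_OA (F ord0) ->
    (0 < liminf_pinfty (fun x =>
           ereal_inf (range (fun l => (tail (F l) x / tail (F ord0) x)%:E))))%E ->
    (limsup_pinfty (fun x =>
           ereal_sup (range (fun l => (tail (F l) x / tail (F ord0) x)%:E)))
       < +oo)%E ->
    class_OA FS) /\
  (* 4 *)
  (forall X Y : {RV P >-> R}, independent X Y ->
    let F := distribution P X in
    let G := distribution P Y in
    let FG := distribution P (X + Y : {RV P >-> R}) in
    tail_pos F -> tail_pos G ->
    has_support F `[0, +oo[%classic -> has_support G `[0, +oo[%classic ->
    (class_L F /\ class_OA F /\ class_OA G) \/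
    (class_L G /\ class_OA G /\ class_OA F) ->
    class_OA FG) /\
  (* 5 *)
  (forall X Y : {RV P >-> R}, independent X Y ->
    let F := distribution P X in
    let G := distribution P Y in
    let FG := distribution P (X + Y : {RV P >-> R}) in
    tail_pos F -> tail_pos G ->
    has_support F `[0, +oo[%classic -> has_support G `[0, +oo[%classic ->
    class_L F -> class_OA F -> class_L G -> class_OA G ->
    class_L FG /\ class_OA FG).
Proof.
split.
  move=> X Y /tail_sum HE F G FG F0 G0 _ _.
  split=> [PDF /(dominated_of_littleo F0) GF _|[OLF PDF] /(dominated_of_littleo F0) GF _].
    exact: (class_PD_sum_dominated F0 G0 HE).
  by split; [exact: (class_OL_sum F0 G0 HE)|exact: (class_PD_sum_dominated F0 G0 HE)].
split.
  move=> X Y /tail_sum HE F G FG F0 G0 _ _ f g _ _ _ bF0 _ [q [bFq qbG lq]].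
  (* [q] is at least the positive index of F; nonnegativity makes x^q monotone. *)
  have q0 : 0 <= q by rewrite -lee_fin (le_trans (ltW bF0)).
  have GF := dominated_of_index F0 G0 q0 qbG lq.
  split=> [[OSF PDF] [OSG _]|[OLF PDF] _]; split.
  - exact: (class_OS_sum F0 G0 HE).
  - exact: (class_PD_sum_dominated F0 G0 HE).
  - exact: (class_OL_sum F0 G0 HE).
  - exact: (class_PD_sum_dominated F0 G0 HE).
split.
  move=> n X indX F FS F0 _ [OSF PDF] _ sup.
  (* All tails are O(F_1), hence so is that of the sum; F_1 is in turn dominated by the sum, and OS
     and PD pass between equivalent tails. *)
  have XF i : dominated (tail (F i)) (tail (F ord0)).
    exact: (dominated_of_limsup_sup i (F0 ord0) sup).
  have uI : uniq (index_enum 'I_n.+2) by exact: index_enum_uniq.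
  have SF : dominated (tail FS) (tail (F ord0)).
    exact: (dominated_tail_sum_seq indX (F0 ord0) OSF XF uI).
  have [|S0 FS0] := tail_sum_seq_ge indX F0 uI.
    by apply/eqP => I0; have := mem_index_enum (ord0 : 'I_n.+2); rewrite I0.
  have {}FS0 := FS0 ord0 (mem_index_enum _).
  split; first exact: (class_OS_equiv (F0 ord0) S0 SF FS0).
  exact: (class_PD_equiv (F0 ord0) S0 SF FS0).
(* Closure of OA under independent sums serves both remaining claims. *)
have OA (X Y : {RV P >-> R}) : independent X Y ->
    let F := distribution P X in let G := distribution P Y in
    tail_pos F -> tail_pos G -> class_OA F -> class_OA G ->
    class_OA (distribution P (X + Y : {RV P >-> R})).
  move=> /tail_sum HE F G F0 G0 [OSF PDF] [OSG PDG]; split.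
    exact: (class_OS_sum F0 G0 HE).
  exact: (class_PD_sum F0 G0 HE).
split.
  by move=> X Y XY F G FG F0 G0 _ _ [[_ [OF OG]]|[_ [OG OF]]]; exact: OA.
move=> X Y XY F G FG F0 G0 _ _ LF OF LG OG; split; last exact: OA.
exact: (class_L_sum F0 G0 (tail_sum XY)).
Qed.
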